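(* Let $(M,\phi,\xi,\eta,g)$ be a contact metric $(\kappa,\mu)$-space which is not $K$-contact, and let $\lambda=\sqrt{1-\kappa}$. Then the Legendrian foliations $\mathcal{F}_\lambda$ and $\mathcal{F}_{-\lambda}$ are either non-degenerate or flat. More precisely, $\mathcal{F}_\lambda$ (respectively, $\mathcal{F}_{-\lambda}$) is flat if and only if $\kappa+\mu\lambda-(\lambda+1)^2=0$ (respectively, $\kappa-\mu\lambda-(\lambda-1)^2=0$), otherwise being non-degenerate.
   Context: Conventions: $d\eta(V,W)=\frac12\big(V(\eta(W))-W(\eta(V))-\eta([V,W])\big)$; $R_{VW}=[\nabla_V,\nabla_W]-\nabla_{[V,W]}$ with $\nabla$ the Levi-Civita connection. A contact metric manifold is a $(2n+1)$-dimensional Riemannian manifold $(M,g)$ with a $(1,1)$-tensor field $\phi$, a $1$-form $\eta$ and a vector field $\xi$ (the Reeb vector field) such that $\eta(\xi)=1$, $\phi^2V=-V+\eta(V)\xi$, $g(\phi V,\phi W)=g(V,W)-\eta(V)\eta(W)$ and $d\eta=\Phi$, where $\Phi(V,W)=g(V,\phi W)$. Put $\mathcal{D}=\ker\eta$ and $h=\frac12\mathcal{L}_\xi\phi$ (Lie derivative). It is $K$-contact if $\xi$ is Killing, equivalently $h\equiv0$. A contact metric $(\kappa,\mu)$-space is a contact metric manifold such that for some real numbers $\kappa,\mu$ and all vector fields $V,W$, $$R_{VW}\xi=\kappa(\eta(W)V-\eta(V)W)+\mu(\eta(W)hV-\eta(V)hW).$$ It is known that $\kappa\le1$, that $\kappa=1$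 implies $h=0$ (Sasakian), and that for $\kappa<1$ the eigenvalues of $h$ are $0,\pm\lambda$ with $\lambda=\sqrt{1-\kappa}$, with mutually orthogonal integrable eigendistributions $\mathbb{R}\xi$, $\mathcal{D}_\lambda$, $\mathcal{D}_{-\lambda}$; the last two are Legendrian, and the Legendrian foliations they define are denoted $\mathcal{F}_\lambda$, $\mathcal{F}_{-\lambda}$. A Legendrian foliation $\mathcal{F}$ is a foliation whose tangent bundle $T\mathcal{F}$ is an $n$-dimensional subbundle of $\mathcal{D}$ with $d\eta(X,X')=0$ for all $X,X'\in\Gamma(T\mathcal{F})$. Its invariant is the symmetric bilinear form on $T\mathcal{F}$ given by $\Pi_{\mathcal{F}}(X,X')=-(\mathcal{L}_X\mathcal{L}_{X'}\eta)(\xi)=-\eta([X',[X,\xi]])$. $\mathcal{F}$ is called non-degenerate, degenerate or flat according to whether $\Pi_{\mathcal{F}}$ is non-degenerate, degenerate or vanishes identically, respectively. *)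

(* Defs.v *)
From HB Require Import structures.
From mathcomp Require Import all_boot all_order all_algebra.
From mathcomp Require Import all_classical all_reals all_analysis.
From mathcomp Require Import ring.

Set Implicit Arguments.
Unset Strict Implicit.
Unset Printing Implicit Defensive.

Import Order.TTheory GRing.Theory Num.Theory.
Import numFieldNormedType.Exports.

Local Open Scope classical_set_scope.
Local Open Scope ring_scope.

Section euclidean.
Context {R : realType} {m : nat}.
Implicit Types (U : set 'rV[R]_m) (f g : 'rV[R]_m -> R).

(* Only meaningful for open U. *)
Fixpoint Ck_on (k : nat) U f : Prop :=
  (forall x, U x -> {for x, continuous f}) /\
  if k is k'.+1 then
    forall i : 'I_m,
      (forall x, U x -> derivable f x (delta_mx 0 i)) /\
      Ck_on k' U (fun x => 'D_(delta_mx 0 i) f x)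
  else True.

Definition smooth_on U f := forall k, Ck_on k U f.

Lemma Ck_on_cont k U f : Ck_on k U f -> forall x, U x -> {for x, continuous f}.
Proof. by case: k => [|k] []. Qed.

Lemma Ck_onW k U f : Ck_on k.+1 U f -> Ck_on k U f.
Proof.
elim: k f => [|k IH] f; first by case=> cf _; split.
case=> cf Hf; split=> // i; have [df Hd] := Hf i.
by split=> //; apply: IH.
Qed.

Lemma eq_Ck_on k U f g : open U -> (forall x, U x -> f x = g x) ->
  Ck_on k U f -> Ck_on k U g.
Proof.
move=> oU; elim: k f g => [|k IH] f g fg Hf;
  have near_fg x : U x -> \forall y \near x, f y = g y by
    move=> Ux; apply: filterS fg _; apply: open_nbhs_nbhs.
all: have cg x : U x -> {for x, continuous g} by
  move=> Ux; rewrite /prop_for /continuous_at -(fg _ Ux);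
  apply: cvg_trans (near_eq_cvg (near_fg _ Ux)) (Ck_on_cont Hf Ux).
  by split.
split=> // i; have [_ /(_ i) [df Hd]] := Hf; split.
  by move=> x Ux; apply: near_eq_derivable (df _ Ux); exact: near_fg.
by apply: IH Hd => x Ux; apply: near_eq_derive; exact: near_fg.
Qed.

Lemma Ck_on_cst k U (c : R) : open U -> Ck_on k U (cst c).
Proof.
move=> oU; elim: k c => [|k IH] c; first by split=> // x _; exact: cst_continuous.
split; first by move=> x _; exact: cst_continuous.
move=> i; split; first by move=> x _; exact: derivable_cst.
by apply: (eq_Ck_on oU _ (IH 0)) => x _ /=; rewrite derive_cst.
Qed.

Lemma Ck_onD k U f g : open U -> Ck_on k U f -> Ck_on k U g ->
  Ck_on k U (fun x => f x + g x).
Proof.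
move=> oU; elim: k f g => [|k IH] f g [cf Hf] [cg Hg].
  by split=> // x Ux; apply: continuousD; [exact: cf|exact: cg].
split; first by move=> x Ux; apply: continuousD; [exact: cf|exact: cg].
move=> i; have [df Hf'] := Hf i; have [dg Hg'] := Hg i; split.
  by move=> x Ux; apply: derivableD; [exact: df|exact: dg].
apply: (eq_Ck_on oU _ (IH _ _ Hf' Hg')) => x Ux /=.
by rewrite (deriveD (df _ Ux) (dg _ Ux)).
Qed.

Lemma Ck_onM k U f g : open U -> Ck_on k U f -> Ck_on k U g ->
  Ck_on k U (fun x => f x * g x).
Proof.
move=> oU; elim: k f g => [|k IH] f g Hf Hg.
  by split=> // x Ux; apply: continuousM; [exact: Ck_on_cont Hf _ Ux|exact: Ck_on_cont Hg _ Ux].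
have Hf0 := Ck_onW Hf; have Hg0 := Ck_onW Hg.
split.
  by move=> x Ux; apply: continuousM; [exact: Ck_on_cont Hf _ Ux|exact: Ck_on_cont Hg _ Ux].
move=> i; have [_ /(_ i) [df Hf']] := Hf; have [_ /(_ i) [dg Hg']] := Hg; split.
  by move=> x Ux; apply: derivableM; [exact: df|exact: dg].
apply: (eq_Ck_on oU _ (Ck_onD oU (IH _ _ Hf0 Hg') (IH _ _ Hg0 Hf'))) => x Ux /=.
by rewrite (deriveM (df _ Ux) (dg _ Ux)).
Qed.

Lemma smooth_on_cst U (c : R) : open U -> smooth_on U (cst c).
Proof. by move=> oU k; exact: Ck_on_cst. Qed.

Lemma smooth_onD U f g : open U -> smooth_on U f -> smooth_on U g ->
  smooth_on U (fun x => f x + g x).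
Proof. by move=> oU Hf Hg k; exact: Ck_onD. Qed.

Lemma smooth_onM U f g : open U -> smooth_on U f -> smooth_on U g ->
  smooth_on U (fun x => f x * g x).
Proof. by move=> oU Hf Hg k; exact: Ck_onM. Qed.

End euclidean.

(* [chart_map] and [chart_inv] are total; only their restrictions to
   [chart_dom] and [chart_cod] matter. *)
Record chart (R : realType) (m : nat) (M : topologicalType) := Chart {
  chart_dom : set M;
  chart_cod : set 'rV[R]_m;
  chart_map : M -> 'rV[R]_m;
  chart_inv : 'rV[R]_m -> M;
  chart_dom_open : open chart_dom;
  chart_cod_open : open chart_cod;
  chart_mapP : forall x, chart_dom x -> chart_cod (chart_map x);
  chart_invP : forall u, chart_cod u -> chart_dom (chart_inv u);
  chart_mapK : forall x, chart_dom x -> chart_inv (chart_map x) = x;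
  chart_invK : forall u, chart_cod u -> chart_map (chart_inv u) = u;
  chart_map_continuous : {within chart_dom, continuous chart_map};
  chart_inv_continuous : {within chart_cod, continuous chart_inv} }.

Definition compatible_charts (R : realType) (m : nat) (M : topologicalType)
    (c c' : chart R m M) : Prop :=
  forall i : 'I_m,
    smooth_on [set u | chart_cod c u /\ chart_dom c' (chart_inv c u)]
              (fun u => chart_map c' (chart_inv c u) ord0 i).

Record smoothManifold (R : realType) (m : nat) := SmoothManifold {
  carrier :> topologicalType;
  manifold_hausdorff : hausdorff_space carrier;
  manifold_second_countable : @second_countable carrier;
  atlas : set (chart R m carrier);
  atlas_cover : forall p : carrier, exists2 c, atlas c & chart_dom c p;
  atlas_compatible :
    forall c c', atlas c -> atlas c' -> compatible_charts c c' }.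

Section smooth_functions.
Context {R : realType} {m : nat} (M : smoothManifold R m).

Definition smooth (f : M -> R) : Prop :=
  forall c, atlas c -> smooth_on (chart_cod c) (fun u => f (chart_inv c u)).

Definition smooth_pred : {pred (M -> R)} := fun f => `[< smooth f >].

Lemma smooth_subring : subring_closed smooth_pred.
Proof.
have smD (f g : M -> R) : smooth f -> smooth g -> smooth (f + g).
  by move=> Hf Hg c Ac; apply: smooth_onD (Hf _ Ac) (Hg _ Ac); exact: chart_cod_open.
have smM (f g : M -> R) : smooth f -> smooth g -> smooth (f * g).
  by move=> Hf Hg c Ac; apply: smooth_onM (Hf _ Ac) (Hg _ Ac); exact: chart_cod_open.
have smC (a : R) : smooth (cst a).
  by move=> c Ac; apply: smooth_on_cst; exact: chart_cod_open.
split.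
- exact/asboolP/smC.
- move=> f g /asboolP Hf /asboolP Hg; apply/asboolP.
  have -> : f - g = f + cst (-1) * g.
    by apply/funext => x; rewrite !fctE /= mulN1r.
  by apply: smD => //; apply: smM.
- by move=> f g /asboolP Hf /asboolP Hg; apply/asboolP/smM.
Qed.

HB.instance Definition _ :=
  GRing.isSubringClosed.Build (M -> R) smooth_pred smooth_subring.

Record smoothFun := SmoothFun {
  smooth_val :> M -> R;
  smooth_valP : smooth_val \in smooth_pred }.

HB.instance Definition _ := [isSub for smooth_val].
HB.instance Definition _ := [Choice of smoothFun by <:].
HB.instance Definition _ :=
  GRing.SubChoice_isSubComPzRing.Build _ _ smoothFun smooth_subring.

Lemma smooth_cst (a : R) : (cst a : M -> R) \in smooth_pred.
Proof.
by apply/asboolP => c Ac; apply: smooth_on_cst; exact: chart_cod_open.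
Qed.

Definition csmooth (a : R) : smoothFun := SmoothFun (smooth_cst a).

End smooth_functions.

Notation "'C^oo(' M )" := (smoothFun M) (at level 0, format "'C^oo(' M )").

(* Vector fields on M are encoded as R-linear derivations of C^oo(M). *)

Section vector_fields.
Context {R : realType} {m : nat} (M : smoothManifold R m).
Local Notation C := C^oo(M).

Definition derivation (X : C -> C) : Prop :=
  (forall (a : R) f g, X (csmooth M a * f + g) = csmooth M a * X f + X g) /\
  (forall f g, X (f * g) = X f * g + f * X g).

Definition derivation_pred : {pred (C -> C^o)} := fun X => `[< derivation X >].

Lemma derivation_submod : submod_closed derivation_pred.
Proof.
split.
  have E (k : C) : (0 : C -> C^o) k = 0 by [].
  by apply/asboolP; split=> *; rewrite !E ?mulr0 ?mul0r addr0.
move=> h X Y /asboolP[Xl XL] /asboolP[Yl YL]; apply/asboolP.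
have E (k : C) : (h *: X + Y : C -> C^o) k = h * X k + Y k by [].
split=> [a f g|f g]; rewrite !E.
  by rewrite Xl Yl !mulrDr addrACA mulrCA.
by rewrite XL YL; ring.
Qed.

HB.instance Definition _ :=
  GRing.isSubmodClosed.Build C (C -> C^o) derivation_pred derivation_submod.

Record vectorField := VectorField {
  vf_val :> C -> C;
  vf_valP : (vf_val : C -> C^o) \in derivation_pred }.

HB.instance Definition _ :=
  [isSub of vectorField for (vf_val : vectorField -> (C -> C^o))].
HB.instance Definition _ := [Choice of vectorField by <:].
HB.instance Definition _ :=
  GRing.SubChoice_isSubLmodule.Build _ _ _ vectorField (GRing.submod_closed_semi derivation_submod).

Lemma lie_bracket_subproof (X Y : vectorField) :
  ((fun f => X (Y f) - Y (X f)) : C -> C^o) \in derivation_pred.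
Proof.
have [/asboolP[Xl XL] /asboolP[Yl YL]] := (vf_valP X, vf_valP Y).
have add (Z : vectorField) f g : Z (f + g) = Z f + Z g.
  have /asboolP[Zl _] := vf_valP Z; have := Zl 1 f g.
  have -> : csmooth M 1 = 1 by exact: val_inj.
  by rewrite !mul1r.
apply/asboolP; split=> [a f g|f g].
  by rewrite Yl Xl Xl Yl opprD addrACA mulrBr.
by rewrite YL XL !add !XL !YL; ring.
Qed.

Definition lie_bracket (X Y : vectorField) : vectorField :=
  VectorField (lie_bracket_subproof X Y).

(* The tangent vector X_p, as a point derivation of C^oo(M). *)
Definition vf_at (p : M) (X : vectorField) : C -> R := fun f => X f p.

End vector_fields.

Notation "'VF(' M )" := (vectorField M) (at level 0, format "'VF(' M )").
Notation "[[ X , Y ]]" := (lie_bracket X Y)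
  (at level 0, format "[[ X ,  Y ]]").

(* Tensor fields are C^oo(M)-multilinear maps on vector fields: 1-forms have
   type [{scalar VF(M)}] and (1,1)-tensor fields type [{linear VF(M) -> VF(M)}]. *)

Section geometry.
Context {R : realType} {m : nat} (M : smoothManifold R m).
Implicit Types (X Y Z V W : VF(M)) (f : C^oo(M)).

Record riemannianMetric := RiemannianMetric {
  metric :> VF(M) -> VF(M) -> C^oo(M);
  metric_sym : forall X Y, metric X Y = metric Y X;
  metric_linear : forall f X Y Z,
    metric (f *: X + Y) Z = f * metric X Z + metric Y Z;
  metric_ge0 : forall X (p : M), 0 <= metric X X p;
  metric_definite : forall X (p : M), metric X X p = 0 -> vf_at p X = 0 }.

Record levi_civita (g : riemannianMetric) (nabla : VF(M) -> VF(M) -> VF(M)) :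
    Prop := LeviCivita {
  nabla_linear : forall f X Y Z,
    nabla (f *: X + Y) Z = f *: nabla X Z + nabla Y Z;
  nabla_add : forall X Y Z, nabla X (Y + Z) = nabla X Y + nabla X Z;
  nabla_leibniz : forall f X Y, nabla X (f *: Y) = X f *: Y + f *: nabla X Y;
  nabla_torsion_free : forall X Y, nabla X Y - nabla Y X = [[X, Y]];
  nabla_metric : forall X Y Z,
    X (g Y Z) = g (nabla X Y) Z + g Y (nabla X Z) }.

Definition curvature (nabla : VF(M) -> VF(M) -> VF(M)) V W Z : VF(M) :=
  nabla V (nabla W Z) - nabla W (nabla V Z) - nabla [[V, W]] Z.

Definition killing (g : riemannianMetric) (xi : VF(M)) : Prop :=
  forall X Y, xi (g X Y) = g [[xi, X]] Y + g X [[xi, Y]].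

Definition ext_d (eta : VF(M) -> C^oo(M)) V W : C^oo(M) :=
  csmooth M 2^-1 * (V (eta W) - W (eta V) - eta [[V, W]]).

Definition lie_form X (alpha : VF(M) -> C^oo(M)) : VF(M) -> C^oo(M) :=
  fun Z => X (alpha Z) - alpha [[X, Z]].

Definition lie_endo X (T : VF(M) -> VF(M)) : VF(M) -> VF(M) :=
  fun Z => [[X, T Z]] - T [[X, Z]].

End geometry.

Record contactMetric (R : realType) (n : nat)
    (M : smoothManifold R n.*2.+1) := ContactMetric {
  cm_g : riemannianMetric M;
  cm_phi : {linear VF(M) -> VF(M)};
  cm_eta : {scalar VF(M)};
  cm_xi : VF(M);
  cm_eta_xi : cm_eta cm_xi = 1;
  cm_phi2 : forall V, cm_phi (cm_phi V) = - V + cm_eta V *: cm_xi;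
  cm_compat : forall V W,
    cm_g (cm_phi V) (cm_phi W) = cm_g V W - cm_eta V * cm_eta W;
  cm_contact : forall V W, ext_d cm_eta V W = cm_g V (cm_phi W) }.

Section contact.
Context {R : realType} {n : nat} {M : smoothManifold R n.*2.+1}.
Variable c : contactMetric M.
Local Notation eta := (cm_eta c).
Local Notation xi := (cm_xi c).

Definition cm_h (V : VF(M)) : VF(M) :=
  csmooth M 2^-1 *: lie_endo xi (cm_phi c) V.

Definition K_contact : Prop := killing (cm_g c) xi.

(* The Levi-Civita connection is unique, so [exists2] fixes it. *)
Definition kappa_mu_space (kappa mu : R) : Prop :=
  exists2 nabla, levi_civita (cm_g c) nabla &
  forall V W : VF(M),
    curvature nabla V W xi =
      csmooth M kappa *: (eta W *: V - eta V *: W) +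
      csmooth M mu *: (eta W *: cm_h V - eta V *: cm_h W).

(* A Legendrian foliation is represented by the set TF of global sections of its
   tangent bundle; that of F_l is the l-eigenspace of h on vector fields. *)
Definition eigendistribution (l : R) : set VF(M) :=
  [set X | cm_h X = csmooth M l *: X].

(* For X, X' in ker eta this equals - eta [X', [X, xi]], as
   (lie_form X' eta) xi = 2 * ext_d eta X' xi = 0. *)
Definition legendrian_invariant (X X' : VF(M)) : C^oo(M) :=
  - lie_form X (lie_form X' eta) xi.

Definition legendrian_flat (TF : set VF(M)) : Prop :=
  forall X X', TF X -> TF X' -> legendrian_invariant X X' = 0.

(* Every vector of the tangent bundle of the foliation at p is the value at p of
   a global section. *)
Definition legendrian_nondegenerate (TF : set VF(M)) : Prop :=
  forall (p : M) X, TF X ->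
    (forall X', TF X' -> legendrian_invariant X X' p = 0) -> vf_at p X = 0.

End contact.

(* Main.v *)
Require Import Defs.
From HB Require Import structures.
From mathcomp Require Import all_boot all_order all_algebra.
From mathcomp Require Import all_classical all_reals all_analysis.
From mathcomp Require Import ring.

Set Implicit Arguments.
Unset Strict Implicit.
Unset Printing Implicit Defensive.

(** On an eigendistribution of [h] with eigenvalue [l != 0], the invariant of the
    Legendrian foliation is a constant multiple of the metric:
    [Pi (X, X') = (2 + 2 l - mu) g (X, X')] ([legendrian_invariantE]). Hence it is
    either zero or definite up to sign. For [l^2 = 1 - kappa], the constant is
    related to the expression of the theorem by
    [kappa + mu l - (l + 1)^2 = - l (2 + 2 l - mu)], and the cases [l = lambda] and
    [l = - lambda] are instances of one statement
    ([flat_iff_and_nondegenerate]).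

    For the formula, the contact condition gives
    [Pi (X, X') = 2 g (X', phi [X, xi])], and [[X, xi]] is
    [nabla_X xi - nabla_xi X]. The first term is
    [- phi X - phi (h X)] in any contact metric manifold ([nabla_xi]), which
    accounts for [2 + 2 l]. The second is controlled by the curvature
    [R (X, xi) xi]: computed from [nabla_xi] and from [nabla_xi phi = 0]
    ([curvature_xi]) and compared with the nullity condition, its part commuting
    with [phi] gives [h^2 = (kappa - 1) phi^2] ([h_square]) and its part
    anticommuting with [phi] gives [nabla_xi h = mu h phi] ([phi_nabla_h]), which
    accounts for [- mu] ([nabla_xi_eigen]).

    Flatness forces the constant to vanish only if the eigendistribution contains
    a nonzero vector. If [h] were zero then [xi] would be Killing
    ([K_contact_of_h0]); so [h] is nonzero, which yields both [kappa < 1]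
    ([kappa_lt1]) and eigenvectors of either sign ([eigendistribution_neq0]).

    Everything is algebra over the ring of smooth functions: vector fields are
    derivations, so an identity between them is checked on an arbitrary function
    by [ring]. *)

Import Order.TTheory GRing.Theory Num.Theory.
Local Open Scope ring_scope.

(** * Vector fields as derivations *)

(** Reduces a linear consequence [a = b] of an equation [u = v] to an identity,
    which [ring] can verify. *)
Lemma eq_of_subr (V : zmodType) (a b u v : V) : u = v -> a - b = u - v -> a = b.
Proof. by move=> ->; rewrite subrr => /eqP; rewrite subr_eq0 => /eqP. Qed.

Section vector_field_calculus.
Context {R : realType} {m : nat} {M : smoothManifold R m}.
Implicit Types (X Y Z : VF(M)) (f a b : C^oo(M)).

Lemma csmooth_is_zmod_morphism : zmod_morphism (csmooth M).
Proof. by move=> a b; apply/val_inj/funext. Qed.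

Lemma csmooth_is_monoid_morphism : monoid_morphism (csmooth M).
Proof. by split=> [|a b]; apply/val_inj/funext. Qed.

HB.instance Definition _ :=
  GRing.isZmodMorphism.Build _ _ (csmooth M) csmooth_is_zmod_morphism.
HB.instance Definition _ :=
  GRing.isMonoidMorphism.Build _ _ (csmooth M) csmooth_is_monoid_morphism.

Lemma csmooth_half : csmooth M 2^-1 + csmooth M 2^-1 = 1.
Proof. by rewrite -rmorphD -[RHS](rmorph1 (csmooth M)); congr csmooth; field. Qed.

Lemma csmooth_reg (r : R) a : r != 0 -> csmooth M r * a = 0 -> a = 0.
Proof.
move=> r0 ra; rewrite -[a]mul1r -(rmorph1 (csmooth M)) -(mulVf r0).
by rewrite rmorphM -mulrA ra mulr0.
Qed.

Lemma csmooth_eq0_of_double a : a + a = 0 -> a = 0.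
Proof.
move=> a2; rewrite -[a]mul1r -csmooth_half.
transitivity (csmooth M 2^-1 * (a + a)); first by ring.
by rewrite a2 mulr0.
Qed.

Lemma vf_ext X Y : (forall f, X f = Y f) -> X = Y.
Proof. by move=> XY; apply/val_inj/funext. Qed.

Lemma vf_eq0 X : (forall p, vf_at p X = 0) -> X = 0.
Proof.
move=> X0; apply: vf_ext => f; apply/val_inj/funext => p.
exact: (congr1 (fun u : C^oo(M) -> R => u f) (X0 p)).
Qed.

Lemma vfD X f a : X (f + a) = X f + X a.
Proof.
have /asboolP[/(_ 1 f a) + _] := vf_valP X.
by rewrite (rmorph1 (csmooth M)) !mul1r.
Qed.

Lemma vfM X f a : X (f * a) = X f * a + f * X a.
Proof. by have /asboolP[_] := vf_valP X. Qed.

Lemma vf0 X : X 0 = 0.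
Proof. by apply: (addIr (X 0)); rewrite -vfD !add0r. Qed.

Lemma vfN X f : X (- f) = - X f.
Proof. by apply: (addIr (X f)); rewrite -vfD !addNr vf0. Qed.

Lemma vf1 X : X 1 = 0.
Proof. by apply: (addIr (X 1)); rewrite add0r -{3}[1]mulr1 vfM mulr1 mul1r. Qed.

Lemma vf_cst X (r : R) : X (csmooth M r) = 0.
Proof.
have /asboolP[/(_ r 1 0) + _] := vf_valP X.
by rewrite !addr0 mulr1 vf0 vf1 mulr0 addr0.
Qed.

Lemma vf_addE X Y f : (X + Y) f = X f + Y f. Proof. by []. Qed.
Lemma vf_oppE X f : (- X) f = - X f. Proof. by []. Qed.
Lemma vf_zeroE f : (0 : VF(M)) f = 0. Proof. by []. Qed.
Lemma vf_scaleE a X f : (a *: X) f = a * X f. Proof. by []. Qed.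
Lemma vf_bracketE X Y f : [[X, Y]] f = X (Y f) - Y (X f). Proof. by []. Qed.
Definition vfE := (vf_addE, vf_oppE, vf_zeroE, vf_scaleE, vf_bracketE).

Lemma vf_double_inj X Y : X + X = Y + Y -> X = Y.
Proof.
move=> XY; rewrite -[X]scale1r -[Y]scale1r -csmooth_half.
by rewrite !scalerDl -!scalerDr XY.
Qed.

Lemma bracketC X Y : [[X, Y]] = - [[Y, X]].
Proof. by apply: vf_ext => f; rewrite !vfE opprB. Qed.

Lemma bracketXX X : [[X, X]] = 0.
Proof. by apply: vf_ext => f; rewrite !vfE subrr. Qed.

Lemma bracketDr X Y Z : [[X, Y + Z]] = [[X, Y]] + [[X, Z]].
Proof. by apply: vf_ext => f; rewrite !vfE vfD; ring. Qed.

Lemma bracketNr X Y : [[X, - Y]] = - [[X, Y]].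
Proof. by apply: vf_ext => f; rewrite !vfE vfN; ring. Qed.

Lemma bracketZr X a Y : [[X, a *: Y]] = X a *: Y + a *: [[X, Y]].
Proof. by apply: vf_ext => f; rewrite !vfE vfM; ring. Qed.

Lemma bracket_jacobi X Y Z : [[X, [[Y, Z]]]] = [[[[X, Y]], Z]] + [[Y, [[X, Z]]]].
Proof. by apply: vf_ext => f; rewrite !(vfE, vfD, vfN); ring. Qed.

End vector_field_calculus.

(** * Riemannian metrics *)

Section metric_calculus.
Context {R : realType} {m : nat} {M : smoothManifold R m}.
Context (g : riemannianMetric M).
Implicit Types (X Y Z : VF(M)) (a : C^oo(M)).

Lemma metricDl X Y Z : g (X + Y) Z = g X Z + g Y Z.
Proof. by have := metric_linear g 1 X Y Z; rewrite scale1r mul1r. Qed.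

Lemma metric0l Z : g 0 Z = 0.
Proof. by apply: (addIr (g 0 Z)); rewrite -metricDl !add0r. Qed.

Lemma metricZl a X Z : g (a *: X) Z = a * g X Z.
Proof. by have := metric_linear g a X 0 Z; rewrite !addr0 metric0l addr0. Qed.

Lemma metricNl X Z : g (- X) Z = - g X Z.
Proof. by rewrite -scaleN1r metricZl mulN1r. Qed.

Lemma metricDr X Y Z : g Z (X + Y) = g Z X + g Z Y.
Proof. by rewrite !(Defs.metric_sym g Z) metricDl. Qed.

Lemma metric0r Z : g Z 0 = 0.
Proof. by rewrite Defs.metric_sym metric0l. Qed.

Lemma metricZr a X Z : g Z (a *: X) = a * g Z X.
Proof. by rewrite !(Defs.metric_sym g Z) metricZl. Qed.

Lemma metricNr X Z : g Z (- X) = - g Z X.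
Proof. by rewrite !(Defs.metric_sym g Z) metricNl. Qed.

Definition metricE := (metricDl, metricDr, metricNl, metricNr, metricZl,
  metricZr, metric0l, metric0r).

Lemma metric_eq0 X : g X X = 0 -> X = 0.
Proof.
move=> gX0; apply: vf_eq0 => p; apply: (@metric_definite _ _ _ g).
by rewrite gX0.
Qed.

Lemma metric_ext X Y : (forall Z, g X Z = g Y Z) -> X = Y.
Proof.
move=> XY; apply/eqP; rewrite -subr_eq0; apply/eqP/metric_eq0.
by rewrite metricDl metricNl XY subrr.
Qed.

End metric_calculus.

(** * Contact metric structures and the operator h *)

Section contact_metric.
Context {R : realType} {n : nat} {M : smoothManifold R n.*2.+1}.
Context (c : contactMetric M).
Local Notation g := (cm_g c).
Local Notation phi := (cm_phi c).
Local Notation eta := (cm_eta c).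
Local Notation xi := (cm_xi c).
(* Left transparent, [cm_h c V] would unify with scalar multiples, and the
   linearity lemmas for [phi] and [eta] would rewrite inside it. *)
Local Notation h := (locked (cm_h c)).
Implicit Types (V W X Y Z : VF(M)).

Lemma etaZ a X : eta (a *: X) = a * eta X.
Proof. by rewrite linearZ. Qed.

Lemma phiD V W : phi (V + W) = phi V + phi W. Proof. exact: linearD. Qed.
Lemma phiN V : phi (- V) = - phi V. Proof. exact: linearN. Qed.
Lemma phi0 : phi 0 = 0. Proof. exact: linear0. Qed.
Lemma phiZ a V : phi (a *: V) = a *: phi V. Proof. exact: linearZ. Qed.
Definition phiE := (phiD, phiN, phiZ, phi0).

(** By [cm_phi2], [phi (phi xi) = 0], so [phi xi] is a multiple [a xi] of [xi] with
    [a ^ 2 = 0]; real-valued functions have no nilpotents. *)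
Lemma phi_xi : phi xi = 0.
Proof.
have p2 : phi (phi xi) = 0 by rewrite cm_phi2 cm_eta_xi scale1r addNr.
have pE : phi xi = eta (phi xi) *: xi.
  have := cm_phi2 c (phi xi); rewrite p2 linear0 => /eqP.
  by rewrite addrC eq_sym subr_eq0 => /eqP.
have a2 : eta (phi xi) * eta (phi xi) = 0.
  by rewrite -etaZ -linearZ -pE p2 linear0.
suff a0 : eta (phi xi) = 0 by rewrite pE a0 scale0r.
apply/val_inj/funext => p; apply/eqP; rewrite -sqrf_eq0 expr2.
exact/eqP/(congr1 (fun u : C^oo(M) => u p) a2).
Qed.

Lemma eta_phi V : eta (phi V) = 0.
Proof.
have := congr1 phi (cm_phi2 c V).
rewrite cm_phi2 linearD linearN linearZ /= phi_xi scaler0 addr0.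
move=> /(congr1 eta); rewrite linearD linearN etaZ.
rewrite cm_eta_xi mulr1 addNr => /esym/eqP.
by rewrite oppr_eq0 => /eqP.
Qed.

Lemma metric_xi V : g V xi = eta V.
Proof.
have := cm_compat c V xi; rewrite phi_xi metric0r cm_eta_xi mulr1 => /esym/eqP.
by rewrite subr_eq0 => /eqP.
Qed.

Lemma contactE X Z :
  X (eta Z) - Z (eta X) - eta [[X, Z]] = g X (phi Z) + g X (phi Z).
Proof.
by rewrite -cm_contact /ext_d -mulrDl csmooth_half mul1r.
Qed.

Lemma metric_phiC X Z : g X (phi Z) = - g Z (phi X).
Proof.
rewrite -!cm_contact /ext_d (bracketC Z) linearN; ring.
Qed.

Lemma metric_phil X Z : g (phi X) Z = - g X (phi Z).
Proof. by rewrite Defs.metric_sym metric_phiC. Qed.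

(** The Reeb field lies in the kernel of the exterior derivative of [eta],
    because [phi xi = 0]. *)
Lemma eta_bracket_xi W : eta [[xi, W]] = xi (eta W).
Proof.
have := contactE xi W; rewrite cm_eta_xi vf1 subr0 Defs.metric_sym metric_xi eta_phi.
by rewrite addr0 => /eqP; rewrite subr_eq0 => /eqP.
Qed.

Lemma double_h V : h V + h V = [[xi, phi V]] - phi [[xi, V]].
Proof. by rewrite -lock -scalerDl csmooth_half scale1r. Qed.

Lemma hD V W : h (V + W) = h V + h W.
Proof.
apply: vf_double_inj; rewrite addrACA !double_h !(linearD, bracketDr) /=.
by apply: vf_ext => f; rewrite !vfE; ring.
Qed.

Lemma hZ a V : h (a *: V) = a *: h V.
Proof.
apply: vf_double_inj; rewrite -(scalerDr a) !double_h !(linearZ, bracketZr) /=.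
rewrite linearD !linearZ /=.
by apply: vf_ext => f; rewrite !vfE; ring.
Qed.

Lemma hN V : h (- V) = - h V.
Proof. by rewrite -scaleN1r hZ scaleN1r. Qed.

Lemma h_xi : h xi = 0.
Proof.
apply: vf_double_inj; rewrite double_h phi_xi addr0.
rewrite bracketXX linear0 subr0; apply: vf_ext => f; rewrite !vfE vf0; ring.
Qed.

Lemma eta_h V : eta (h V) = 0.
Proof.
apply: csmooth_eq0_of_double.
by rewrite -linearD double_h linearB /= eta_bracket_xi !eta_phi vf0 subr0.
Qed.

(** Both [h phi] and [phi h] expand to brackets with [xi]; in their sum
    everything cancels except the multiple [xi (eta V) - eta [xi, V]] of [xi], which
    is zero by [eta_bracket_xi]. *)
Lemma h_phi V : h (phi V) = - phi (h V).
Proof.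
apply: vf_double_inj; rewrite double_h -opprD -(linearD phi) double_h linearB /=.
rewrite !cm_phi2 bracketDr bracketNr bracketZr eta_bracket_xi.
by rewrite bracketXX; apply: vf_ext => f; rewrite !vfE; ring.
Qed.

(** The Lie derivative of [g] along [xi]: its vanishing is the Killing equation. *)
Definition lie_metric X Z := xi (g X Z) - g [[xi, X]] Z - g X [[xi, Z]].

(** The fundamental form is invariant under the Reeb flow: it is exact, with
    primitive [eta], and the Lie derivative of [eta] along [xi] vanishes. *)
Lemma lie_contact X Z :
  xi (g X (phi Z)) = g [[xi, X]] (phi Z) + g X (phi [[xi, Z]]).
Proof.
apply/eqP; rewrite -subr_eq0; apply/eqP/csmooth_eq0_of_double.
have E1 := contactE X Z; have E2 := contactE [[xi, X]] Z.
have E3 := contactE X [[xi, Z]].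
have := congr1 (fun f => xi f) E1; rewrite !(vfD, vfN) => E4.
have J : eta [[[[xi, X]], Z]] + eta [[X, [[xi, Z]]]] = xi (eta [[X, Z]]).
  by rewrite -linearD -bracket_jacobi eta_bracket_xi.
rewrite !eta_bracket_xi !vfE in E2 E3.
transitivity ((xi (g X (phi Z)) + xi (g X (phi Z)))
  - (g [[xi, X]] (phi Z) + g [[xi, X]] (phi Z))
  - (g X (phi [[xi, Z]]) + g X (phi [[xi, Z]]))); first by ring.
rewrite -E4 -E2 -E3 -J; ring.
Qed.

(** Since the flow of [xi] preserves [g (_, phi _)], the variation of [g] is
    compensated by that of [phi], which is [2 h]. *)
Lemma lie_metric_phi X Z : lie_metric X (phi Z) = - (g X (h Z) + g X (h Z)).
Proof.
rewrite /lie_metric lie_contact -metricDr double_h !metricE; ring.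
Qed.

(** Reduces an identity linear in [V] to the image of [phi] and to [xi]. *)
Lemma phi_decomp V : V = phi (- phi V) + eta V *: xi.
Proof. by rewrite linearN cm_phi2 opprD opprK subrK. Qed.

Lemma lie_metricE X Z : lie_metric X Z = g X (h (phi Z)) + g X (h (phi Z)).
Proof.
have xi0 : lie_metric X xi = 0.
  rewrite /lie_metric !metric_xi eta_bracket_xi subrr sub0r.
  by rewrite bracketXX metric0r oppr0.
have [D S] : (forall Y Y', lie_metric X (Y + Y') =
    lie_metric X Y + lie_metric X Y') /\
  (forall a Y, lie_metric X (a *: Y) = a * lie_metric X Y).
  split=> [Y Y'|a Y]; rewrite /lie_metric ?bracketDr ?bracketZr !metricE.
    by rewrite vfD; ring.
  by rewrite vfM; ring.
rewrite {1}[Z]phi_decomp D S xi0 lie_metric_phi hN !metricE; ring.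
Qed.

Lemma lie_metricC X Z : lie_metric X Z = lie_metric Z X.
Proof.
rewrite /lie_metric (Defs.metric_sym g X Z) (Defs.metric_sym g [[xi, X]]).
rewrite (Defs.metric_sym g X [[_, _]]); ring.
Qed.

(** The Lie derivative of the symmetric form [g] is symmetric; on the image of
    [phi] this says that [g (phi X, h Z)] is symmetric in [X] and [Z], and [h]
    anticommutes with the skew operator [phi]. *)
Lemma h_sym X W : g (h X) W = g X (h W).
Proof.
rewrite [W]phi_decomp; move: (- phi W) => Z.
rewrite hD hZ h_xi scaler0 addr0 metricDr metricZr metric_xi eta_h mulr0 addr0.
have := lie_metricC (phi X) (phi Z); rewrite !lie_metric_phi => /oppr_inj E.
have {E} : g (phi X) (h Z) = g (phi Z) (h X).
  apply/eqP; rewrite -subr_eq0; apply/eqP/csmooth_eq0_of_double.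
  transitivity (g (phi X) (h Z) + g (phi X) (h Z)
    - (g (phi Z) (h X) + g (phi Z) (h X))); first by ring.
  by rewrite E subrr.
by rewrite h_phi metricNr -metric_phil (Defs.metric_sym g (h X)) => ->.
Qed.

Lemma K_contact_of_h0 : (forall V, h V = 0) -> K_contact c.
Proof.
move=> h0 X Y; have := lie_metricE X Y; rewrite h0 metric0r addr0 => /eqP.
rewrite /lie_metric -addrA -opprD subr_eq0 => /eqP ->; ring.
Qed.

Lemma phi3 V : phi (phi (phi V)) = - phi V.
Proof. by rewrite cm_phi2 eta_phi scale0r addr0. Qed.

Lemma phi2_h V : phi (phi (h V)) = - h V.
Proof. by rewrite cm_phi2 eta_h scale0r addr0. Qed.

(** * The Levi-Civita connection along the Reeb field *)

Section connection.
Context (nabla : VF(M) -> VF(M) -> VF(M)) (LC : levi_civita g nabla).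

Lemma nabla_xi_skew X Z :
  g (nabla X xi) Z - g (nabla Z xi) X = g X (phi Z) + g X (phi Z).
Proof.
have m1 := nabla_metric LC X xi Z; have m2 := nabla_metric LC Z xi X.
rewrite !(Defs.metric_sym g xi) !metric_xi in m1 m2.
by rewrite -contactE -(nabla_torsion_free LC) linearB /= m1 m2; ring.
Qed.

Lemma nabla_xi_sym X Z :
  g (nabla X xi) Z + g (nabla Z xi) X = lie_metric X Z.
Proof.
rewrite /lie_metric (nabla_metric LC) -!(nabla_torsion_free LC) !metricE.
by rewrite (Defs.metric_sym g X (nabla Z xi)); ring.
Qed.

(** The skew part of [g (nabla_X xi, Z)] in [X] and [Z] comes from the exterior
    derivative of [eta], its symmetric part from the Lie derivative of [g]. *)
Lemma nabla_xi X : nabla X xi = - phi X - phi (h X).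
Proof.
apply: (metric_ext (g := g)) => Z.
apply/eqP; rewrite -subr_eq0; apply/eqP/csmooth_eq0_of_double.
rewrite !metricE !metric_phil.
have E1 := nabla_xi_skew X Z; have := nabla_xi_sym X Z.
rewrite lie_metricE -h_sym => E2.
transitivity ((g (nabla X xi) Z - g (nabla Z xi) X)
  + (g (nabla X xi) Z + g (nabla Z xi) X)
 - (g X (phi Z) + g X (phi Z)) - (g (h X) (phi Z) + g (h X) (phi Z))).
  by ring.
by rewrite E1 E2; ring.
Qed.

Lemma nabla_xi_xi : nabla xi xi = 0.
Proof. by rewrite nabla_xi h_xi phi0 phi_xi oppr0 addr0. Qed.

Lemma nabla0r X : nabla X 0 = 0.
Proof.
by apply: (addIr (nabla X 0)); rewrite -(nabla_add LC) !add0r.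
Qed.

Lemma nablaNr X Y : nabla X (- Y) = - nabla X Y.
Proof.
by apply: (addIr (nabla X Y)); rewrite -(nabla_add LC) !addNr nabla0r.
Qed.

Lemma bracket_xi_r X : [[X, xi]] = - phi X - phi (h X) - nabla xi X.
Proof. by rewrite -nabla_xi (nabla_torsion_free LC). Qed.

(** With [nabla_xi Y] replaced by [[xi, Y] + nabla_Y xi], the difference of the two
    sides becomes [2 h X + 2 phi^2 (h X)], which vanishes because [eta (h X) = 0]. *)
Lemma nabla_xi_phi X : nabla xi (phi X) = phi (nabla xi X).
Proof.
have nE Y : nabla xi Y = [[xi, Y]] - phi Y - phi (h Y).
  rewrite bracketC bracket_xi_r.
  by apply: vf_ext => f; rewrite !vfE; ring.
have : [[xi, phi X]] = h X + h X + phi [[xi, X]] by rewrite double_h subrK.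
rewrite !nE !phiE h_phi phiN phi2_h => ->.
by apply: vf_ext => f; rewrite !vfE; ring.
Qed.

(** The term [nabla_X (nabla_xi xi)] vanishes, and
    [nabla_Y xi = - phi Y - phi (h Y)] turns the others into derivatives along
    [xi], through which [phi] can be moved. *)
Lemma curvature_xi X :
  curvature nabla X xi xi =
    phi (nabla xi (h X) - h (nabla xi X)) - phi (phi X) - h (h X).
Proof.
rewrite /curvature nabla_xi_xi nabla0r !nabla_xi bracket_xi_r.
rewrite !(nabla_add LC, nablaNr) !nabla_xi_phi.
rewrite !(hD, hN, phiE) !h_phi !phiE !phi2_h.
by apply: vf_ext => f; rewrite !vfE; ring.
Qed.

(** * The nullity condition *)

Section kappa_mu.
Context (kappa mu : R) (curv : forall V W : VF(M),
  curvature nabla V W xi =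
    csmooth M kappa *: (eta W *: V - eta V *: W) +
    csmooth M mu *: (eta W *: cm_h c V - eta V *: cm_h c W)).

Lemma curvature_xi_kappa_mu X :
  phi (nabla xi (h X) - h (nabla xi X)) =
    phi (phi X) + h (h X) - csmooth M kappa *: phi (phi X)
    + csmooth M mu *: h X.
Proof.
have : curvature nabla X xi xi = csmooth M kappa *: (eta xi *: X - eta X *: xi)
    + csmooth M mu *: (eta xi *: h X - eta X *: h xi) by rewrite -lock.
rewrite curvature_xi cm_eta_xi !scale1r h_xi scaler0 subr0.
have -> : X - eta X *: xi = - phi (phi X).
  by rewrite cm_phi2 opprD opprK.
move=> E; apply: (eq_of_subr E).
by apply: vf_ext => f; rewrite !vfE; ring.
Qed.

(** Replacing [X] by [phi X] in the curvature identity flips the relative sign of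
    the terms anticommuting with [phi], namely [phi (nabla_xi h)] and [mu h]; adding
    the two versions isolates the terms that commute with [phi]. *)
Lemma h_square X : h (h X) = csmooth M (kappa - 1) *: phi (phi X).
Proof.
pose A := phi (phi X) + h (h X) - csmooth M kappa *: phi (phi X).
have A0 : phi A = 0.
  apply: vf_double_inj.
  have E := congr1 phi (curvature_xi_kappa_mu X).
  have := curvature_xi_kappa_mu (phi X).
  rewrite nabla_xi_phi !h_phi !(phiN, hN) nablaNr nabla_xi_phi h_phi.
  rewrite /A !phiE in E *.
  move=> E'; apply: (eq_of_subr (esym E)); apply: (eq_of_subr (esym E')).
  by apply: vf_ext => f; rewrite !vfE; ring.
have := congr1 phi A0.
rewrite phi0 /A cm_phi2 !(linearD, linearN, etaZ) /=.
rewrite !(eta_phi, eta_h, mulr0, oppr0, addr0, scale0r) => E.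
apply: (eq_of_subr (esym E)).
by rewrite rmorphB rmorph1; apply: vf_ext => f; rewrite !vfE; ring.
Qed.

(** What remains of the curvature identity after [h_square]; it amounts to
    [nabla_xi h = mu (h phi)]. *)
Lemma phi_nabla_h X :
  phi (nabla xi (h X) - h (nabla xi X)) = csmooth M mu *: h X.
Proof.
rewrite curvature_xi_kappa_mu h_square rmorphB rmorph1.
by apply: vf_ext => f; rewrite !vfE; ring.
Qed.

(** * The invariant on an eigendistribution *)

Section eigenvectors.
Context (l : R) (l_neq0 : l != 0).

Lemma eigendistributionE X :
  eigendistribution c l X = (h X = csmooth M l *: X).
Proof. by rewrite -lock. Qed.

Lemma eta_eigen X : eigendistribution c l X -> eta X = 0.
Proof.
rewrite eigendistributionE => hX; apply: (csmooth_reg l_neq0).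
by rewrite -etaZ -hX eta_h.
Qed.

(** Pair [phi_nabla_h] with [X']. Moving [phi] and [h] across the metric, the two
    terms [nabla_xi (h X)] and [h (nabla_xi X)] contribute equally, since [phi]
    exchanges the eigenvalues [l] and [- l]. *)
Lemma nabla_xi_eigen X X' :
  eigendistribution c l X -> eigendistribution c l X' ->
  g X' (phi (nabla xi X)) + g X' (phi (nabla xi X)) =
    csmooth M mu * g X X'.
Proof.
rewrite !eigendistributionE => hX hX'.
apply/eqP; rewrite -subr_eq0; apply/eqP/(csmooth_reg l_neq0).
have := congr1 (g X') (phi_nabla_h X).
rewrite hX (nabla_leibniz LC) vf_cst scale0r add0r.
rewrite !phiE !metricE.
have -> : g X' (phi (h (nabla xi X))) = - (csmooth M l * g X' (phi (nabla xi X))).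
  rewrite -[phi (h _)]opprK -h_phi metricNr -h_sym hX'.
  by rewrite metricZl.
move=> E; apply: (eq_of_subr E).
by rewrite (Defs.metric_sym g X); ring.
Qed.

(** The invariant is [2 g (X', phi [X, xi])], and
    [phi [X, xi] = (1 + l) X - phi (nabla_xi X)] on the eigendistribution. *)
Lemma legendrian_invariantE X X' :
  eigendistribution c l X -> eigendistribution c l X' ->
  legendrian_invariant c X X' = csmooth M (2 + 2 * l - mu) * g X X'.
Proof.
move=> hX hX'; have Pi := nabla_xi_eigen hX hX'.
have eX := eta_eigen hX; have eX' := eta_eigen hX'.
have := contactE X' [[X, xi]].
rewrite /legendrian_invariant /lie_form cm_eta_xi vf1 sub0r.
rewrite (bracketC X' xi) linearN /= opprK eta_bracket_xi eX' !vf0 !subr0 sub0r.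
rewrite opprK => ->.
rewrite eigendistributionE in hX; rewrite bracket_xi_r hX !phiE cm_phi2 eX scale0r.
rewrite addr0 !metricE.
apply: (eq_of_subr (esym Pi)).
rewrite !(rmorphB, rmorphD, rmorphM) /= (Defs.metric_sym g X).
ring.
Qed.

(** As [h^2 = l^2] on the contact distribution, [h V + l V] is an eigenvector for
    every [V = phi U]. If all of these vanished, [h] would be [- l] on the image of
    [phi]; but [phi] exchanges opposite eigenvalues, so [h] would be zero. *)
Lemma eigendistribution_neq0 : l ^+ 2 = 1 - kappa -> (exists V, h V <> 0) ->
  exists2 X, eigendistribution c l X & exists p : M, g X X p != 0.
Proof.
move=> l2 [U hU]; apply: contrapT => noX; apply: hU.
have E V : h (phi V) + csmooth M l *: phi V = 0.
  apply: contrapT => X0; apply: noX; set X := _ + _ in X0; exists X.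
    rewrite eigendistributionE /X hD hZ h_square phi3 -[kappa - 1]opprB -l2.
    by rewrite rmorphN expr2 rmorphM; apply: vf_ext => f; rewrite !vfE; ring.
  apply: contrapT => gX; apply: X0; apply: (metric_eq0 (g := g)).
  apply/val_inj/funext => p; apply/eqP/negP => /negP gXp; apply: gX.
  by exists p.
have hphi2 : h (phi (phi U)) = - h U by rewrite !h_phi phiN phi2_h opprK.
have E1 := E (phi U); have E2 := congr1 phi (E U).
rewrite hphi2 in E1; rewrite h_phi !phiE phi2_h opprK in E2.
apply: vf_double_inj; rewrite addr0.
apply: (eq_of_subr E2); apply: (eq_of_subr (esym E1)).
by apply: vf_ext => f; rewrite !vfE; ring.
Qed.

End eigenvectors.

(** [g (h V, h V) = (1 - kappa) g (phi V, phi V)]. *)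
Lemma kappa_lt1 : (exists V, h V <> 0) -> kappa < 1.
Proof.
move=> [V hV]; rewrite ltNge; apply/negP => k1; apply: hV.
apply: (metric_eq0 (g := g)); apply/val_inj/funext => p.
apply/eqP; rewrite eq_le; apply/andP; split; last exact: metric_ge0.
rewrite h_sym h_square metricZr -[g V _]opprK -metric_phil mulrN.
rewrite -[_ <= _]/(- ((kappa - 1) * g (phi V) (phi V) p) <= 0) oppr_le0.
by rewrite mulr_ge0 ?subr_ge0 //; exact: metric_ge0.
Qed.

(** With [kappa = 1 - l^2], the expression [e] factors as [- l (2 + 2 l - mu)], so it
    vanishes exactly when the coefficient of the metric in the invariant does. *)
Lemma flat_iff_and_nondegenerate (l : R) : l != 0 -> l ^+ 2 = 1 - kappa ->
  (exists V, h V <> 0) ->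
  let F := eigendistribution c l in
  let e := kappa + mu * l - (l + 1) ^+ 2 in
  (legendrian_flat c F <-> e = 0) /\ (e <> 0 -> legendrian_nondegenerate c F).
Proof.
move=> l0 l2 hn0 F e.
have eE : e = - l * (2 + 2 * l - mu).
  have kE : kappa = 1 - l ^+ 2 by rewrite l2; ring.
  by rewrite /e kE; ring.
have e0 : e = 0 <-> 2 + 2 * l - mu = 0.
  rewrite eE; split=> [/eqP|->]; last by rewrite mulr0.
  by rewrite mulf_eq0 oppr_eq0 (negPf l0) => /eqP.
rewrite e0; split; first split.
- move=> flat; have [X FX [q gX] ] := eigendistribution_neq0 l2 hn0.
  have := flat X X FX FX; rewrite (legendrian_invariantE l0 FX FX).
  move=> /(congr1 (fun f : C^oo(M) => f q)).
  rewrite -[LHS]/((2 + 2 * l - mu) * g X X q) => /eqP.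
  by rewrite mulf_eq0 (negPf gX) orbF => /eqP.
- by move=> k0 X X' FX FX'; rewrite (legendrian_invariantE l0 FX FX') k0 rmorph0 mul0r.
- move=> k0 p X FX /(_ X FX); rewrite (legendrian_invariantE l0 FX FX).
  rewrite -[LHS]/((2 + 2 * l - mu) * g X X p) => /eqP.
  rewrite mulf_eq0; case/orP => [/eqP /k0 //|/eqP gX].
  exact: metric_definite gX.
Qed.

End kappa_mu.

End connection.
End contact_metric.

Theorem proposition3p1 (R : realType) (n : nat)
    (M : smoothManifold R n.*2.+1) (c : contactMetric M) (kappa mu : R)
    (c_kappa_mu : kappa_mu_space c kappa mu) (c_not_K : ~ K_contact c) :
  let lambda := Num.sqrt (1 - kappa) in
  let Fp := eigendistribution c lambda in
  let Fm := eigendistribution c (- lambda) in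
  [/\ legendrian_nondegenerate c Fp \/ legendrian_flat c Fp,
      legendrian_nondegenerate c Fm \/ legendrian_flat c Fm,
      (legendrian_flat c Fp <-> kappa + mu * lambda - (lambda + 1) ^+ 2 = 0) /\
      (kappa + mu * lambda - (lambda + 1) ^+ 2 <> 0 -> legendrian_nondegenerate c Fp) &
      (legendrian_flat c Fm <-> kappa - mu * lambda - (lambda - 1) ^+ 2 = 0) /\
      (kappa - mu * lambda - (lambda - 1) ^+ 2 <> 0 -> legendrian_nondegenerate c Fm)].
Proof.
move=> lambda Fp Fm; case: c_kappa_mu => nabla LC curv.
have hn0 : exists V, locked (cm_h c) V <> 0.
  by apply: contrapT => h0; apply/c_not_K/K_contact_of_h0 => V;
    apply: contrapT => hV; apply: h0; exists V.
have k1 := kappa_lt1 LC curv hn0.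
have l0 : lambda != 0 by rewrite sqrtr_eq0 -ltNge subr_gt0.
have l2 : lambda ^+ 2 = 1 - kappa by rewrite sqr_sqrtr // subr_ge0 ltW.
have P := flat_iff_and_nondegenerate LC curv l0 l2 hn0.
have Q : (legendrian_flat c Fm <-> kappa - mu * lambda - (lambda - 1) ^+ 2 = 0) /\
      (kappa - mu * lambda - (lambda - 1) ^+ 2 <> 0 -> legendrian_nondegenerate c Fm).
  have -> : kappa - mu * lambda - (lambda - 1) ^+ 2 =
     kappa + mu * - lambda - (- lambda + 1) ^+ 2 by ring.
  by apply: (flat_iff_and_nondegenerate LC curv); rewrite ?oppr_eq0 ?sqrrN.
have dichotomy (F : set VF(M)) (e : R) :
    (legendrian_flat c F <-> e = 0) /\ (e <> 0 -> legendrian_nondegenerate c F) ->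
    legendrian_nondegenerate c F \/ legendrian_flat c F.
  by move=> [ [_ flat] nondeg]; have [/flat|/nondeg] := pselect (e = 0); [right|left].
by split=> //; [exact: dichotomy P|exact: dichotomy Q].
Qed.
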